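(* For any given graph $G$, $\mathrm{boxicity}(G^{\boxtimes d})$ and $\mathrm{cubicity}(G^{\boxtimes d})$, as functions of $d$, are in $O(d)$; and there exist graphs $G$ for which they are in $\Omega(d)$.
   Context: All graphs are finite, undirected and simple. A $k$-box is a Cartesian product of $k$ closed intervals of $\mathbb{R}$, and a $k$-cube is a Cartesian product of $k$ closed intervals of unit length. A $k$-box ($k$-cube) representation of a graph $G$ is a function $f$ mapping each vertex to a $k$-box ($k$-cube) such that for any two distinct vertices $u,v$, $uv\in E(G)$ if and only if $f(u)\cap f(v)\neq\emptyset$. The boxicity (cubicity) of $G$ is the smallest natural number $k$ (with $0$ allowed; complete graphs have boxicity and cubicity $0$) such that $G$ has a $k$-box ($k$-cube) representation. The strong product $G_1\boxtimes G_2$ is the graph on $V(G_1)\times V(G_2)$ in which two distinct vertices $(u_1,u_2)$ and $(v_1,v_2)$ are adjacent if and only if ($u_1=v_1$ or $u_1v_1\in E(G_1)$) and ($u_2=v_2$ or $u_2v_2\in E(G_2)$). $G^{\boxtimes d}$ is the strong product of $d$ copies of $G$. The graph $G$ is fixed and asymptotics are as $d\to\infty$; implied constants may depend on $G$. *)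

(* Defs.v *)
From HB Require Import structures.
From mathcomp Require Import all_boot all_order all_algebra.
From mathcomp Require Import all_classical all_reals all_analysis.
From mathcomp Require Import lra.

Set Implicit Arguments.
Unset Strict Implicit.
Unset Printing Implicit Defensive.

Import Order.TTheory GRing.Theory Num.Theory.
Import numFieldNormedType.Exports.

Local Open Scope classical_set_scope.
Local Open Scope ring_scope.

Record sgraph : Type := SGraph {
  vertex :> finType;
  edge : rel vertex;
  edge_sym : symmetric edge;
  edge_irr : irreflexive edge
}.

Section StrongProduct.
Variables G H : sgraph.

Definition strong_edge : rel (G * H)%type := fun u v =>
  [&& u != v, (u.1 == v.1) || edge u.1 v.1 & (u.2 == v.2) || edge u.2 v.2].

Lemma strong_edge_sym : symmetric strong_edge.
Proof.
move=> u v; rewrite /strong_edge eq_sym (eq_sym u.1) (eq_sym u.2).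
by rewrite (edge_sym u.1) (edge_sym u.2).
Qed.

Lemma strong_edge_irr : irreflexive strong_edge.
Proof. by move=> u; rewrite /strong_edge eqxx. Qed.

Definition strong_prod : sgraph := SGraph strong_edge_sym strong_edge_irr.

End StrongProduct.

Definition K1 : sgraph :=
  @SGraph unit (fun _ _ => false) (fun _ _ => erefl) (fun _ => erefl).

(* [strong_pow G 1] is [G] itself and [strong_pow G d.+2] is
   [strong_prod G (strong_pow G d.+1)]; the empty product is the one-vertex
   graph. *)
Definition strong_pow (G : sgraph) (d : nat) : sgraph :=
  iterop d strong_prod G K1.

Section Representations.
Variable R : realType.

(* The bound [a i <= b i] excludes the empty set: an empty side would let a vertex
   avoid all its non-neighbours for free. *)
Definition is_box (k : nat) (B : set ('I_k -> R)) : Prop :=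
  exists a b : 'I_k -> R, (forall i, a i <= b i) /\
    B = [set x | forall i, x i \in `[a i, b i]].

Definition is_cube (k : nat) (B : set ('I_k -> R)) : Prop :=
  exists a : 'I_k -> R, B = [set x | forall i, x i \in `[a i, a i + 1]].

Definition is_intersection_rep (G : sgraph) (T : Type) (f : G -> set T) : Prop :=
  forall u v : G, u != v -> (edge u v <-> f u `&` f v !=set0).

Definition has_box_rep (G : sgraph) (k : nat) : Prop :=
  exists f : G -> set ('I_k -> R),
    (forall v, is_box (f v)) /\ is_intersection_rep f.

Definition has_cube_rep (G : sgraph) (k : nat) : Prop :=
  exists f : G -> set ('I_k -> R),
    (forall v, is_cube (f v)) /\ is_intersection_rep f.

Lemma has_cube_box_rep G k : has_cube_rep G k -> has_box_rep G k.
Proof.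
move=> [f [fc fr]]; exists f; split=> // v.
have [a ->] := fc v; exists a, (fun i => a i + 1); split=> // i.
by rewrite lerDl ler01.
Qed.

(* One coordinate per vertex w: the side of v is [0, 1] if v = w, [1, 2] if v is
   adjacent to w, and [2, 3] otherwise. *)
Lemma has_cube_rep_card G : has_cube_rep G #|G|.
Proof.
pose a (v : G) (i : 'I_#|G|) : R := let w := enum_val i in
  if v == w then 0 else if edge w v then 1 else 2.
exists (fun v => [set x | forall i, x i \in `[a v i, a v i + 1]]).
split=> [v|u v uv]; first by exists (a v).
split=> [euv|[x [/= xu xv]]].
- exists (fun i => Num.max (a u i) (a v i)); split=> i /=;
    rewrite in_itv /= le_max ge_max lexx ?orbT lerDl ler01 ?andbT /=;
    rewrite /a; set w := enum_val i;
    have [uw|_] := eqVneq u w; have [vw|_] := eqVneq v w;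
    try (by move: uv; rewrite uw vw eqxx);
    try (rewrite -uw euv); try (rewrite -vw edge_sym euv); try lra;
    by case: ifP => _; try case: ifP => _; lra.
- apply/negPn/negP => nuv.
  move: (xu (enum_rank u)) (xv (enum_rank u)).
  rewrite !in_itv /= /a enum_rankK eqxx eq_sym (negPf uv) (negPf nuv).
  by move=> /andP[_ h1] /andP[h2 _]; lra.
Qed.

Lemma exists_box_rep G : exists k, `[< has_box_rep G k >].
Proof.
by exists #|G|; apply/asboolP/has_cube_box_rep/has_cube_rep_card.
Qed.

Lemma exists_cube_rep G : exists k, `[< has_cube_rep G k >].
Proof. by exists #|G|; apply/asboolP/has_cube_rep_card. Qed.

Definition boxicity (G : sgraph) : nat := ex_minn (exists_box_rep G).

Definition cubicity (G : sgraph) : nat := ex_minn (exists_cube_rep G).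

End Representations.

(* Main.v *)
(** Cube representations of the factors concatenate to one of the strong
   product, so the cubicity of the [d]-th power is at most [d] times that of [G].
   Conversely, let [G] be the path on three vertices.  The vertices of its [d]-th
   power having an end of the path in one coordinate and the centre in all the
   others induce a cocktail party graph with [d] non-edges.  In a box
   representation each non-edge is separated in some coordinate, and no
   coordinate separates two of them, since an induced 4-cycle is not an interval
   graph; hence the boxicity is at least [d]. *)
Require Import Defs.
From mathcomp Require Import all_boot all_order all_algebra.
From mathcomp Require Import all_classical all_reals all_analysis.
From mathcomp Require Import lra.
Import Order.TTheory GRing.Theory Num.Theory.
Import numFieldNormedType.Exports.
Local Open Scope classical_set_scope.
Local Open Scope ring_scope.

(** With equality allowed, the strong product becomes a plain conjunction over the factors, and
    representations need no side condition that [u] and [v] differ. *)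
Definition closed_edge {G : sgraph} : rel G :=
  fun u v => (u == v) || edge u v.

Lemma closed_edge_refl (G : sgraph) : reflexive (@closed_edge G).
Proof. by move=> u; rewrite /closed_edge eqxx. Qed.

Lemma edge_closed_edge (G : sgraph) (u v : G) :
  u != v -> edge u v = closed_edge u v.
Proof. by move=> /negPf uv; rewrite /closed_edge uv. Qed.

Lemma closed_edge_strong (G H : sgraph) (u v : strong_prod G H) :
  closed_edge u v = closed_edge u.1 v.1 && closed_edge u.2 v.2.
Proof.
rewrite /closed_edge /= /strong_edge; have [->|//] := eqVneq u v.
by rewrite !eqxx.
Qed.

Section BoxRepresentations.
Variable R : realType.

(** The pointwise maximum of the lower ends serves as a common point. *)
Lemma box_meetP {k : nat} {a b a' b' : 'I_k -> R} :
  (forall i, a i <= b i) -> (forall i, a' i <= b' i) ->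
  ([set x : 'I_k -> R | forall i, x i \in `[a i, b i]] `&`
   [set x | forall i, x i \in `[a' i, b' i]] !=set0)
  <-> (forall i, a i <= b' i /\ a' i <= b i).
Proof.
move=> ab ab'; split=> [[x [/= xab xab']] i|meet].
- move: (xab i) (xab' i); rewrite !in_itv /= => /andP[ax xb] /andP[ax' xb'].
  by split; [exact: le_trans xb' | exact: le_trans xb].
- exists (fun i => Num.max (a i) (a' i)); split=> i /=; have [ab1 ab2] := meet i;
    rewrite in_itv /= le_max ge_max lexx ?orbT ?ab ?ab' ?ab1 ?ab2 //.
Qed.

Lemma box_rep_bounds (G : sgraph) (k : nat) : has_box_rep R G k ->
  exists a b : G -> 'I_k -> R,
    forall u v, closed_edge u v <-> forall i, a u i <= b v i /\ a v i <= b u i.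
Proof.
move=> [f [fbox frep]].
have [a /choice[b ab]] := choice fbox.
exists a, b => u v; have [<-|uv] := eqVneq u v.
  by rewrite closed_edge_refl; split=> // _ i; have [le_ab _] := ab u.
rewrite -edge_closed_edge // (frep u v uv).
have [abu ->] := ab u; have [abv ->] := ab v.
exact: box_meetP.
Qed.

(** A unit cube is determined by its lower corner, and two of them meet exactly when their corners
    are at sup-distance at most 1. *)
Lemma has_cube_repP (G : sgraph) (k : nat) : has_cube_rep R G k <->
  exists a : G -> 'I_k -> R, forall u v,
    closed_edge u v <-> forall i, a u i <= a v i + 1 /\ a v i <= a u i + 1.
Proof.
have le1 (a : 'I_k -> R) i : a i <= a i + 1 by rewrite lerDl ler01.
split=> [[f [/choice[a fa] frep]]|[a aP]].
- exists a => u v; have [<-|uv] := eqVneq u v.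
    by rewrite closed_edge_refl; split.
  rewrite -edge_closed_edge // (frep u v uv) !fa.
  exact: (box_meetP (le1 _) (le1 _)).
- exists (fun v => [set x | forall i, x i \in `[a v i, a v i + 1]]).
  split=> [v|u v uv]; first by exists (a v).
  rewrite edge_closed_edge // aP.
  by apply: iff_sym; exact: (box_meetP (le1 _) (le1 _)).
Qed.

Lemma has_cube_rep_strong (G H : sgraph) (m n : nat) :
  has_cube_rep R G m -> has_cube_rep R H n ->
  has_cube_rep R (strong_prod G H) (m + n).
Proof.
move=> /has_cube_repP[a aP] /has_cube_repP[b bP]; apply/has_cube_repP.
exists (fun (u : strong_prod G H) i =>
  match fintype.split i with inl j => a u.1 j | inr j => b u.2 j end).
move=> u v; rewrite closed_edge_strong; split=> [/andP[]|uv].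
- by move=> /aP uv1 /bP uv2 i; case: (fintype.split i).
- apply/andP; split.
  + by apply/aP=> j; have := uv (unsplit (inl j)); rewrite unsplitK.
  + by apply/bP=> j; have := uv (unsplit (inr j)); rewrite unsplitK.
Qed.

(** The induction starts at exponent 1, where the power is [G] itself and not a product with
    [K1]. *)
Lemma has_cube_rep_strong_pow (G : sgraph) (k d : nat) :
  has_cube_rep R G k -> has_cube_rep R (strong_pow G d.+1) (d.+1 * k).
Proof.
move=> Gk; elim: d => [|d IHd]; first by rewrite mul1n.
by rewrite mulSn; exact: has_cube_rep_strong.
Qed.

Lemma cubicity_rep (G : sgraph) : has_cube_rep R G (cubicity R G).
Proof. by rewrite /cubicity; case: ex_minnP => k /asboolP. Qed.

Lemma cubicity_min (G : sgraph) (k : nat) :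
  has_cube_rep R G k -> (cubicity R G <= k)%N.
Proof.
by move=> Gk; rewrite /cubicity; case: ex_minnP => m _; apply; exact/asboolP.
Qed.

Lemma boxicity_rep (G : sgraph) : has_box_rep R G (boxicity R G).
Proof. by rewrite /boxicity; case: ex_minnP => k /asboolP. Qed.

Lemma boxicity_le_cubicity (G : sgraph) : (boxicity R G <= cubicity R G)%N.
Proof.
rewrite {1}/boxicity; case: ex_minnP => m _; apply.
by apply/asboolP/has_cube_box_rep/cubicity_rep.
Qed.

Lemma cubicity_strong_pow (G : sgraph) (d : nat) :
  (cubicity R (strong_pow G d.+1) <= d.+1 * cubicity R G)%N.
Proof. by apply/cubicity_min/has_cube_rep_strong_pow/cubicity_rep. Qed.

End BoxRepresentations.

(** Distinct pairs are automatically disjoint: a shared vertex would be adjacent to its own partner.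
    Indices in [nat] make it easy to shift the pairs when one is added. *)
Definition cocktail_party {G : sgraph} (d : nat) (p : nat -> bool -> G) : Prop :=
  (forall i, (i < d)%N -> ~~ closed_edge (p i true) (p i false)) /\
  (forall i j x y, (i < d)%N -> (j < d)%N -> i != j ->
     closed_edge (p i x) (p j y)).

Lemma cocktail_party_boxicity (R : realType) (G : sgraph) (d : nat)
    (p : nat -> bool -> G) :
  cocktail_party d p -> (d <= boxicity R G)%N.
Proof.
move=> [pairs others].
have [a [b abP]] := box_rep_bounds _ _ _ (boxicity_rep R G).
have sep (i : 'I_d) : exists c, b (p i true) c < a (p i false) c \/
    b (p i false) c < a (p i true) c.
  apply: contrapT => noc; have /negP := pairs i (ltn_ord i); apply.
  apply/abP => c; split; rewrite leNgt; apply/negP => lt; apply: noc; exists c.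
    by right.
  by left.
have [s sP] := choice sep.
have s_inj : injective s.
  move=> i j sij; apply/val_inj/eqP/negPn/negP => ij.
  have adj x y := (abP _ _).1 (others i j x y (ltn_ord i) (ltn_ord j) ij) (s i).
  move: (sP i) (sP j) (adj true true) (adj true false) (adj false true)
    (adj false false); rewrite -sij {sij}.
  (* If, say, [true] lies below [false] in both pairs, then in this coordinate [b (p i true) < a (p
     i false) <= b (p j true) < a (p j false) <= b (p i true)], a cycle. *)
  by move=> [?|?] [?|?] [? ?] [? ?] [? ?] [? ?]; lra.
by have := leq_card s s_inj; rewrite !card_ord.
Qed.

Lemma P3_edge_sym : symmetric (fun u v : option bool => isSome u (+) isSome v).
Proof. by move=> u v; rewrite addbC. Qed.

Lemma P3_edge_irr : irreflexive (fun u v : option bool => isSome u (+) isSome v).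
Proof. by move=> u; rewrite addbb. Qed.

(* The path whose centre is [None] and whose ends are [Some true], [Some false]. *)
Definition P3 : sgraph := SGraph P3_edge_sym P3_edge_irr.

(* The universal vertex is what lets the induction pad the new pair. *)
Lemma P3_pow_cocktail_party (d : nat) :
  exists (t : strong_pow P3 d.+1) (p : nat -> bool -> strong_pow P3 d.+1),
    (forall v, closed_edge t v /\ closed_edge v t) /\ cocktail_party d.+1 p.
Proof.
elim: d => [|d [t [p [tU [pairs others]]]]].
  exists (None : P3), (fun _ x => Some x : P3); split; first by case=> [[]|].
  by split=> [|[|?] [|?]].
exists ((None : P3, t) : strong_prod P3 _).
(* The new pair, at index 0, joins the two ends of the path to [t]; the old pairs move up by one and
   receive the centre. *)
exists (fun i x => (if i is j.+1 then (None : P3, p j x) else (Some x : P3, t))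
  : strong_prod P3 _).
split=> [[v w]|].
  by rewrite !closed_edge_strong /=; have [-> ->] := tU w; case: v => [[]|].
split=> [[|i]|[|i] [|j] x y] //; rewrite ?ltnS closed_edge_strong /=.
- exact: pairs.
- by move=> *; rewrite (tU _).1.
- by move=> *; rewrite (tU _).2.
- by rewrite eqSS => *; rewrite others.
Qed.

Lemma boxicity_P3_pow (R : realType) (d : nat) :
  (d <= boxicity R (strong_pow P3 d))%N.
Proof.
case: d => // d; have [t [p [_ pP]]] := P3_pow_cocktail_party d.
exact: cocktail_party_boxicity pP.
Qed.

(** The claim is asymptotic, so a bound at positive arguments suffices; this is the range that
    [cubicity_strong_pow] covers. *)
Lemma eqO_nat (R : realType) (f g : nat -> nat) (c : nat) :
  (forall n, (f n.+1 <= c * g n.+1)%N) ->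
  (fun n => (f n)%:R : R) =O_\oo (fun n => (g n)%:R : R).
Proof.
(* The constant must be positive, while [c] may be 0, as for complete graphs. *)
move=> fg; apply/eqO_exP; exists c.+1%:R => //.
exists 1%N => // -[|n] //= _.
rewrite !normr_nat -natrM ler_nat (leq_trans (fg n)) // leq_mul2r leqnSn.
by rewrite orbT.
Qed.

Lemma eqOmega_nat (R : realType) (f g : nat -> nat) :
  (forall n, (g n <= f n)%N) ->
  (fun n => (f n)%:R : R) =Omega_\oo (fun n => (g n)%:R : R).
Proof.
move=> gf; rewrite eqOmegaE eqOmegaO; apply: (@eqO_nat _ _ _ 1) => n.
by rewrite mul1n.
Qed.

Theorem corollary2 (R : realType) :
  (forall G : sgraph,
     (fun d : nat => (boxicity R (strong_pow G d))%:R : R)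
       =O_\oo (fun d : nat => d%:R : R) /\
     (fun d : nat => (cubicity R (strong_pow G d))%:R : R)
       =O_\oo (fun d : nat => d%:R : R)) /\
  (exists G : sgraph,
     (fun d : nat => (boxicity R (strong_pow G d))%:R : R)
       =Omega_\oo (fun d : nat => d%:R : R) /\
     (fun d : nat => (cubicity R (strong_pow G d))%:R : R)
       =Omega_\oo (fun d : nat => d%:R : R)).
Proof.
split=> [G|].
- have cubG n : (cubicity R (strong_pow G n.+1) <= cubicity R G * n.+1)%N.
    by rewrite mulnC cubicity_strong_pow.
  split; last exact: (@eqO_nat R _ id _ cubG).
  apply: (@eqO_nat R _ id (cubicity R G)) => n.
  by rewrite (leq_trans (boxicity_le_cubicity _ _)).
- exists P3; split; first exact: (@eqOmega_nat R _ id (boxicity_P3_pow R)).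
  apply: (@eqOmega_nat R _ id) => n.
  exact: leq_trans (boxicity_P3_pow R n) (boxicity_le_cubicity _ _).
Qed.
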